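(* Let $N=pd$ with $p,d$ positive integers, let $q_1,\dots,q_K$ be all the positive divisors of $N$, and consider the system $$\mathcal R_{p,N}:=\{L_{pk}c_{q_1}\}_{k=0}^{d-1}\cup\{L_{pk}c_{q_2}\}_{k=0}^{d-1}\cup\cdots\cup\{L_{pk}c_{q_K}\}_{k=0}^{d-1}\subset \ell^2(\mathbb Z_N).$$ Assume $K\ge p$. Then: (i) (Case $p=1$, $N=d$.) The system $\mathcal R_{1,N}$ is a tight frame for $\ell^2(\mathbb Z_N)$ with bound $N^2$. (ii) (Case $p=2$, $N=2d$.) If $d$ is odd, the system $\mathcal R_{2,N}$ is a tight frame for $\ell^2(\mathbb Z_N)$ with bound $2d^2$. If $d$ is even, $\mathcal R_{2,N}$ is not a frame for $\ell^2(\mathbb Z_N)$. (iii) For any $p>2$, $\mathcal R_{p,N}$ is not a frame for $\ell^2(\mathbb Z_N)$.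
   Context: $\ell^2(\mathbb Z_N)$ is the $N$-dimensional complex Hilbert space of functions on $\mathbb Z_N=\{0,1,\dots,N-1\}$ (identified with $N$-periodic functions on $\mathbb Z$), with $\langle x,y\rangle=\sum_{n=0}^{N-1}x(n)\overline{y(n)}$. For $m\in\mathbb Z$, the circular shift is $L_mx(n)=x(n-m)$. For a positive integer $q$, the $q$-th Ramanujan sum is $c_q(n)=\sum_{1\le k\le q,\,(k,q)=1}e^{2\pi i kn/q}$; it is $q$-periodic, so for $q\mid N$ it is regarded as an element of $\ell^2(\mathbb Z_N)$. The system $\mathcal R_{p,N}$ is understood as a family indexed by $(k,i)\in\{0,\dots,d-1\}\times\{1,\dots,K\}$. A finite family $(f_j)$ in a finite-dimensional Hilbert space $H$ is a frame for $H$ if there are constants $A,B>0$ with $A\|x\|^2\le\sum_j|\langle x,f_j\rangle|^2\le B\|x\|^2$ for all $x\in H$; it is a tight frame with bound $A$ if this holds with $A=B$. *)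

(* Defs.v *)
From HB Require Import structures.
From mathcomp Require Import all_boot all_order all_algebra.
From mathcomp Require Import complex.
From mathcomp Require Import reals trigo.

Set Implicit Arguments.
Unset Strict Implicit.
Unset Printing Implicit Defensive.

Import Order.TTheory GRing.Theory Num.Theory.

Local Open Scope ring_scope.
Local Open Scope complex_scope.

(* l^2(Z_N) is 'rV[R[i]]_N; its inner product is dotmx, which is conjugate
   linear in the second argument. *)
Lemma dotmx_sumE (R : realType) (N : nat) (x y : 'rV[R[i]]_N) :
  dotmx x y = \sum_(n < N) x 0 n * Num.conj (y 0 n).
Proof.
by rewrite dotmxE mxE; apply: eq_bigr => n _; rewrite !mxE.
Qed.

(* The residue of a mod N. The argument n only shows that N > 0: the default
   value of insubd is never reached, see residueE. *)
Definition residue (N : nat) (n : 'I_N) (a : int) : 'I_N :=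
  insubd n `|(a %% N%:Z)%Z|%N.

Lemma residueE (N : nat) (n : 'I_N) (a : int) :
  (residue n a)%:Z = (a %% N%:Z)%Z.
Proof.
have N0 : N%:Z != 0 by case: N n => [[]|].
have a0 : 0 <= (a %% N%:Z)%Z by exact: modz_ge0.
have aE : `|(a %% N%:Z)%Z|%N%:Z = (a %% N%:Z)%Z by exact: gez0_abs.
have aN : (`|(a %% N%:Z)%Z| < N)%N by rewrite -ltz_nat aE ltz_pmod //; case: N n {N0 a0 aE} => [[]|].
by rewrite /residue val_insubd aN aE.
Qed.

Definition shift (R : realType) (N : nat) (m : int) (x : 'rV[R[i]]_N) :
  'rV[R[i]]_N := \row_(n < N) x 0 (residue n (n%:Z - m)).

Definition expi (R : realType) (t : R) : R[i] := cos t +i* sin t.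

Definition ramanujan (R : realType) (q : nat) (n : int) : R[i] :=
  \sum_(1 <= k < q.+1 | coprime k q)
    expi (2 * pi * k%:R * n%:~R / q%:R : R).

Definition ramanujan_vec (R : realType) (N q : nat) : 'rV[R[i]]_N :=
  \row_(n < N) ramanujan R q n%:Z.

Definition frame_bounds (R : realType) (N : nat) (J : finType)
    (f : J -> 'rV[R[i]]_N) (A B : R) : Prop :=
  [/\ 0 < A, 0 < B & forall x : 'rV[R[i]]_N,
    A%:C * dotmx x x <= \sum_j `|dotmx x (f j)| ^+ 2 <= B%:C * dotmx x x].

Definition is_frame (R : realType) (N : nat) (J : finType)
    (f : J -> 'rV[R[i]]_N) : Prop :=
  exists A B : R, frame_bounds f A B.

Definition is_tight_frame (R : realType) (N : nat) (J : finType)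
    (f : J -> 'rV[R[i]]_N) (A : R) : Prop :=
  frame_bounds f A A.

Definition ramanujan_system (R : realType) (N p d K : nat)
    (q : K.-tuple nat) (j : 'I_d * 'I_K) : 'rV[R[i]]_N :=
  shift (p * j.1)%N%:Z (ramanujan_vec R N (tnth q j.2)).

(* Main.v *)
(** With [e_a(n) = e^(2 i pi a n / N)], one has
    [c_t = \sum_(gcd(a,N) = N/t) e_a], so that the correlations of the shifts
    by multiples of [p] only couple two frequencies [a = b mod d] with
    [gcd(a,N) = gcd(b,N)].  For [p = 1], and for [p = 2] with [d] odd, this
    forces [a = b] and the Gram kernel is [d N] times the identity.  In the
    other cases a nonzero vector orthogonal to the whole system is written
    down: the difference of the indicators of the classes [1] and [-1] mod [p]
    when [p > 2], and [delta_1 - delta_(1+d)] when [p = 2] and [d] is even. *)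
Require Import Defs.
From mathcomp Require Import all_boot all_order all_algebra.
From mathcomp Require Import complex.
From mathcomp Require Import reals trigo.
From mathcomp Require Import zify ring lra.

Import Order.TTheory GRing.Theory Num.Theory.

Local Open Scope ring_scope.

(** * Roots of unity and their orthogonality *)

Lemma conjCE (R : realType) (z : R[i]) : Num.conj z = conjc z.
Proof. by []. Qed.

Definition omega (R : realType) (N : nat) (a : int) : R[i] :=
  expi (2 * pi * a%:~R / N%:R : R).

Lemma expiD (R : realType) (s t : R) : expi (s + t) = expi s * expi t.
Proof. by rewrite /expi cosD sinD; congr Complex; rewrite // addrC [_ * cos t]mulrC. Qed.

Lemma expi0 (R : realType) : expi (0 : R) = 1.
Proof. by rewrite /expi cos0 sin0. Qed.

Lemma conj_expi (R : realType) (t : R) : Num.conj (expi t) = expi (- t).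
Proof. by rewrite conjCE /expi cosN sinN. Qed.

Lemma expi_2pi_nat (R : realType) (n : nat) : expi (2 * pi * n%:R : R) = 1.
Proof.
elim: n => [|n IH]; first by rewrite mulr0 expi0.
rewrite -[n.+1%:R]natr1 mulrDr mulr1 expiD IH mul1r.
by rewrite mulr_natl /expi cos2pi sin2pi.
Qed.

Lemma expi_2pi (R : realType) (a : int) : expi (2 * pi * a%:~R : R) = 1.
Proof.
case: a => n; first exact: expi_2pi_nat.
by rewrite NegzE rmorphN mulrN -conj_expi (expi_2pi_nat R n.+1) rmorph1.
Qed.

Lemma omegaD (R : realType) (N : nat) (a b : int) :
  omega R N (a + b) = omega R N a * omega R N b.
Proof. by rewrite /omega intrD mulrDr mulrDl expiD. Qed.

Lemma omega0 (R : realType) (N : nat) : omega R N 0 = 1.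
Proof. by rewrite /omega mulr0 mul0r expi0. Qed.

Lemma conj_omega (R : realType) (N : nat) (a : int) :
  Num.conj (omega R N a) = omega R N (- a).
Proof. by rewrite /omega conj_expi rmorphN mulrN mulNr. Qed.

Lemma omegaX (R : realType) (N : nat) (a : int) (k : nat) :
  omega R N (a * k%:Z) = omega R N a ^+ k.
Proof.
elim: k => [|k IH]; first by rewrite mulr0 omega0.
by rewrite exprSr -IH -omegaD; congr omega; lia.
Qed.

Lemma omega_scale (R : realType) (N c : nat) (a : int) : (0 < c)%N ->
  omega R (N * c) (a * c%:Z) = omega R N a.
Proof.
move=> c0; have c1 : c%:R != 0 :> R by rewrite pnatr_eq0 -lt0n.
by rewrite /omega intrM natrM mulrA -mulf_div [_ / c%:R]divff // mulr1.
Qed.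

Lemma omega_eqmod (R : realType) (N : nat) (a b : int) : (0 < N)%N ->
  (a == b %[mod N%:Z])%Z -> omega R N a = omega R N b.
Proof.
move=> N0; rewrite eqz_mod_dvd => /dvdzP[c cE].
have -> : a = b + c * N%:Z by rewrite -cE addrC subrK.
rewrite omegaD -[X in omega R X (c * _)]mul1n omega_scale// /omega divr1 expi_2pi.
by rewrite mulr1.
Qed.

Lemma omega_eq1 (R : realType) (N : nat) (a : int) : (0 < N)%N ->
  (omega R N a == 1) = (N%:Z %| a)%Z.
Proof.
move=> N0; apply/eqP/idP; last first.
  move=> Na; rewrite -(omega0 R N); apply: omega_eqmod => //.
  by rewrite eqz_mod_dvd subr0.
rewrite (@omega_eqmod _ _ _ (a %% N%:Z)%Z) //; last by rewrite modz_mod.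
have N0' : N%:Z != 0 by rewrite -lt0n in N0 *; lia.
have := modz_ge0 a N0'; have := @ltz_pmod a N%:Z; rewrite ltz_nat N0 => /(_ isT).
have -> : (N%:Z %| a)%Z = ((a %% N%:Z)%Z == 0) by apply/dvdz_mod0P/eqP.
case: (a %% N%:Z)%Z => // -[//|r]; rewrite ltz_nat => rN _.
move=> /(congr1 (@complex.Re R)) w1.
have {w1} : cos (2 * pi * r.+1%:R / N%:R : R) = 1 := w1.
(* Half the angle lies strictly between 0 and pi, so [sin t] is positive, whereas [cos (2 t) = 1]
   would force it to vanish. *)
set t : R := pi * r.+1%:R / N%:R.
have -> : 2 * pi * r.+1%:R / N%:R = t *+ 2 by rewrite -[t *+ 2]mulr_natl /t !mulrA.
have t0 : 0 < sin t.
  apply: sin_gt0_pi; rewrite /t; apply/andP; split.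
    by rewrite divr_gt0 ?mulr_gt0 ?pi_gt0 ?ltr0n.
  by rewrite -mulrA gtr_pMr ?pi_gt0 // ltr_pdivrMr ?ltr0n // mul1r ltr_nat.
rewrite cos_mulr2n => h; have := cos2Dsin2 t; nra.
Qed.

Lemma sum_omega (R : realType) (N : nat) (a : int) : (0 < N)%N ->
  \sum_(k < N) omega R N (a * k%:Z) = if (N%:Z %| a)%Z then N%:R else 0.
Proof.
move=> N0; under eq_bigr do rewrite omegaX.
rewrite -(@omega_eq1 R) //; have [->|w1] := eqVneq.
  by under eq_bigr do rewrite expr1n; rewrite sumr_const card_ord.
(* Geometric sum: multiplying by [omega R N a - 1] telescopes it to the N-th power minus 1, which is
   0. *)
apply: (mulfI (x := omega R N a - 1)); first by rewrite subr_eq0.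
rewrite mulr0 -subrX1 -omegaX; apply/eqP; rewrite subr_eq0 omega_eq1 //.
exact: dvdz_mull.
Qed.

(** * Ramanujan sums: expansion in characters, parity and vanishing *)

Lemma ramanujan_ord (R : realType) (q : nat) (n : int) : (0 < q)%N ->
  ramanujan R q n = \sum_(k < q | coprime k q) omega R q (k%:Z * n).
Proof.
move=> q0; rewrite -(big_mkord (fun k => coprime k q) (fun k => omega R q (k%:Z * n))).
rewrite /ramanujan [LHS]big_mkcond [RHS]big_mkcond /=.
(* The index q is traded for the index 0. Both have gcd q with q, so they contribute only when q =
   1, and then both terms are 1. *)
rewrite big_nat_recr //= (@big_ltn _ _ _ 0 q) //=.
rewrite addrC; congr (_ + _); last first.
  by apply: eq_bigr => k _; rewrite /omega intrM mulrA.
rewrite /coprime gcdnn gcd0n; case: eqP => // ->.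
by rewrite mul0r omega0 divr1 mulr1 expi_2pi.
Qed.

Lemma ramanujan_eqmod (R : realType) (q : nat) (a b : int) : (0 < q)%N ->
  (a == b %[mod q%:Z])%Z -> ramanujan R q a = ramanujan R q b.
Proof.
move=> q0 ab; rewrite !ramanujan_ord //; apply: eq_bigr => k _.
by apply: omega_eqmod => //; rewrite -modzMmr (eqP ab) modzMmr.
Qed.

(* The divisor N/q of N is attained as gcd(i, N) exactly by the frequencies
   i = k N/q with k prime to q. *)
Lemma ramanujan_gcdn (R : realType) (N q : nat) (n : int) :
  (0 < N)%N -> (q %| N)%N ->
  ramanujan R q n = \sum_(i < N | gcdn i N == (N %/ q)%N) omega R N (i%:Z * n).
Proof.
move=> N0 qN; have q0 : (0 < q)%N by apply: dvdn_gt0 qN.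
rewrite ramanujan_ord //.
have [c NE] : exists c, N = (q * c)%N by exists (N %/ q)%N; rewrite mulnC divnK.
have c0 : (0 < c)%N by move: N0; rewrite NE muln_gt0 => /andP[].
have cE : (N %/ q)%N = c by rewrite NE mulKn.
rewrite cE.
have hlt (k : 'I_q) : (k * c < N)%N by rewrite NE ltn_pmul2r.
have glt (i : 'I_N) : (i %/ c < q)%N by rewrite ltn_divLR // -NE.
rewrite (reindex_onto (fun k => Ordinal (hlt k)) (fun i => Ordinal (glt i))) /=; last first.
  move=> i /eqP ic; apply: val_inj => /=; rewrite divnK //.
  by rewrite -ic dvdn_gcdl.
apply: eq_big => [k|k _].
  have -> : Ordinal (glt (Ordinal (hlt k))) == k.
    by apply/eqP/val_inj; rewrite /= mulnK.
  rewrite andbT /coprime NE -muln_gcdl -{2}(mul1n c) eqn_pmul2r //.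
by rewrite NE PoszM mulrAC omega_scale.
Qed.

(** The substitution k -> -k in Z_q preserves coprimality with q. *)
Lemma ramanujanN (R : realType) (q : nat) (n : int) : (0 < q)%N ->
  ramanujan R q (- n) = ramanujan R q n.
Proof.
case: q => // q _; rewrite !ramanujan_ord // (reindex_inj oppr_inj) /=.
apply: eq_big => [k|k _]; last first.
  apply: omega_eqmod => //=; rewrite -modz_nat modzMml eqz_mod_dvd -subzn ?(ltnW (ltn_ord k)) //.
  by apply/dvdzP; exists (- n); ring.
rewrite /= coprime_modl /coprime.
have /subnKC : (k <= q.+1)%N by exact: ltnW.
move: (_ - _)%N => m; move: (k : nat) => {}k <-.
by rewrite gcdnDr gcdnDl gcdnC.
Qed.

(* k -> k + q/2 permutes the residues prime to q and multiplies each term by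
   e^(i pi n) = -1. *)
Lemma ramanujan_odd0 (R : realType) (q : nat) (n : int) : (0 < q)%N ->
  (4 %| q)%N -> ~~ (2 %| n)%Z -> ramanujan R q n = 0.
Proof.
move=> q0 /dvdnP[r qE] n2.
have r0 : (0 < r)%N by lia.
have qr : (q = 2 * (2 * r))%N by lia.
pose z := omega R q ((2 * r)%N%:Z * n).
have z1 : z != 1.
  rewrite /z omega_eq1 // qr; apply: contra n2 => /dvdzP[c cE].
  by apply/dvdzP; exists c; nia.
suff : ramanujan R q n = z * ramanujan R q n.
  move=> /eqP; rewrite -subr_eq0 -[X in X - _]mul1r -mulrBl mulf_eq0 subr_eq0.
  by rewrite eq_sym (negPf z1) => /eqP.
rewrite ramanujan_ord // mulr_sumr.
case: q q0 qE qr @z {z1} => // q q0 qE qr z.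
rewrite (reindex_inj (addrI (inord (2 * r)))) /=.
apply: eq_big => [k|k _].
  rewrite inordK; last by lia.
  rewrite coprime_modl; move: (k : nat) => {}k.
  (* Prime to q means prime to 2 and to q/2 = 2r; adding the even number 2r affects neither
     condition. *)
  rewrite qr !(coprimeMr _ 2 (2 * r)) !coprimen2 oddD oddM /=.
  by congr (_ && _); rewrite /coprime gcdnC gcdnDl gcdnC.
rewrite /z -omegaD inordK; last by lia.
apply: omega_eqmod => //; rewrite -modz_nat modzMml eqz_mod_dvd -mulrDl.
by rewrite -PoszD subrr dvdz0.
Qed.

(** * Criteria for failing to be a frame and for being a tight one *)

Lemma orthogonal_not_frame (R : realType) (N : nat) (J : finType)
    (f : J -> 'rV[R[i]]_N) (x : 'rV[R[i]]_N) :
  x != 0 -> (forall j, dotmx x (f j) = 0) -> ~ is_frame f.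
Proof.
move=> x0 xf [A [B [A0 _ /(_ x)/andP[+ _]]]].
rewrite big1 => [|j _]; last by rewrite xf normr0 expr0n.
by rewrite lt_geF //; apply: mulr_gt0; [rewrite (ltcR 0 A) | apply: dotmx_is_dotmx].
Qed.

(** The kernel condition says that the frame operator, the sum of [<., f_j> f_j], is A times the
    identity. Expanding each squared modulus over pairs (n, m) then leaves only the diagonal. *)
Lemma gram_tight_frame (R : realType) (N : nat) (J : finType)
    (f : J -> 'rV[R[i]]_N) (A : R) : 0 < A ->
  (forall n m, \sum_j Num.conj (f j 0 n) * f j 0 m = (n == m)%:R * (A%:C)%C) ->
  is_tight_frame f A.
Proof.
move=> A0 fA; split=> // x.
suff -> : \sum_j `|dotmx x (f j)| ^+ 2 = (A%:C)%C * dotmx x x by rewrite lexx.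
pose h n m j := (x 0 n * Num.conj (x 0 m)) * (Num.conj (f j 0 n) * f j 0 m).
have hE n m : \sum_j h n m j = x 0 n * Num.conj (x 0 m) * ((n == m)%:R * (A%:C)%C).
  by rewrite -fA mulr_sumr.
transitivity (\sum_j \sum_n \sum_m h n m j).
  apply: eq_bigr => j _; rewrite normCK !dotmx_sumE rmorph_sum big_distrlr.
  apply: eq_bigr => n _; apply: eq_bigr => m _.
  by rewrite rmorphM /= conjCK /h; ring.
rewrite exchange_big dotmx_sumE mulr_sumr; apply: eq_bigr => n _.
rewrite exchange_big /= (eq_bigr _ (fun m _ => hE n m)).
rewrite (bigD1 n) //= big1 => [|m mn].
  by rewrite eqxx addr0 mul1r mulrC.
by rewrite eq_sym (negPf mn) mul0r mulr0.
Qed.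

(** * Entries of the shifted system, and the cases that are not frames *)

Lemma residue_eqmod (N : nat) (n : 'I_N) (a : int) (c : nat) : (c %| N)%N ->
  (c%:Z %| (residue n a)%:Z - a)%Z.
Proof.
move=> cN; rewrite residueE; apply: (@dvdz_trans N%:Z); first by [].
by rewrite -eqz_mod_dvd modz_mod.
Qed.

Lemma ramanujan_systemE (R : realType) (N p d K : nat) (q : K.-tuple nat)
    (j : 'I_d * 'I_K) (n : 'I_N) : (tnth q j.2 %| N)%N ->
  @ramanujan_system R N p d K q j 0 n =
  ramanujan R (tnth q j.2) (n%:Z - (p * j.1)%N%:Z).
Proof.
move=> qN; have N0 : (0 < N)%N by exact: leq_ltn_trans (ltn_ord n).
rewrite !mxE; apply: ramanujan_eqmod; first exact: dvdn_gt0 qN.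
by rewrite eqz_mod_dvd residue_eqmod.
Qed.

(** Serves as a change of summation variable, reflecting Z_N about the centre of a shifted Ramanujan
    sum. *)
Lemma residue_reflect_inv (N : nat) (m : int) :
  involutive (fun n : 'I_N => residue n (m - n%:Z)).
Proof.
move=> n; apply/val_inj/eqP; rewrite -eqz_nat; rewrite residueE.
rewrite -[X in _ == X](@modz_small n N%:Z) ?ltz_nat ?ltn_ord //.
rewrite residueE -modzDmr modzNm modzDmr.
by apply/eqP; congr (_ %% _)%Z; ring.
Qed.

(* The test vector [n = 1 mod p] - [n = -1 mod p] is odd and p-periodic, hence
   orthogonal to the shifts by multiples of p of the even functions c_q. *)
Lemma ramanujan_system_not_frame_gt2 (R : realType) (N p d K : nat)
    (q : K.-tuple nat) : (2 < p)%N -> (0 < d)%N -> N = (p * d)%N ->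
  (forall i, tnth q i %| N)%N -> ~ is_frame (@ramanujan_system R N p d K q).
Proof.
move=> p2 d0 NE qN.
have N2 : (2 < N)%N by rewrite NE; nia.
pose g (a : int) : R[i] := (p%:Z %| a - 1)%Z%:R - (p%:Z %| a + 1)%Z%:R.
have gN a : g (- a) = - g a.
  have -> : - a = 1 - (a + 1) by rewrite opprD addrCA subrr addr0.
  rewrite /g opprB [1 - _ - 1]addrC addKr rpredN.
  by rewrite -(rpredN _ (1 - _ + 1)) opprD opprB addrK.
have gp a b : (p%:Z %| a - b)%Z -> g a = g b.
  move=> ab; rewrite /g -{1 2}(subrK b a) -!(addrA (a - b)).
  by rewrite !(rpredDl _ ab).
apply: (@orthogonal_not_frame _ _ _ _ (\row_n g n%:Z)).
  have N1 : (1 < N)%N by lia.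
  (* The entry at n = 1 is 1 - 0, because p > 2 does not divide 2. *)
  apply/negP => /eqP/rowP/(_ (Ordinal N1)); rewrite !mxE /g /= subrr dvdz0.
  rewrite dvdzE /= gtnNdvd // subr0 => /eqP; by rewrite oner_eq0.
move=> j; rewrite dotmx_sumE; set S := (LHS).
have q0 : (0 < tnth q j.2)%N by apply: dvdn_gt0 (qN _); lia.
suff : - S = S by move=> /eqP; rewrite eqNr => /eqP.
(* The reflection n -> m - n negates [n - p * j.1], which the even sum ignores; as p divides m, it
   also negates n mod p, so g changes sign. *)
pose m : int := 2 * (p * j.1)%N%:Z.
rewrite {2}/S (reindex_inj (can_inj (residue_reflect_inv N m))) /= -sumrN.
apply: eq_bigr => n _; rewrite !ramanujan_systemE // !mxE -mulNr -gN.
have := residue_eqmod N n (m - n%:Z); move: (residue n _) => r rE.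
congr (_ * Num.conj _).
  apply: gp; rewrite -opprB rpredN opprK.
  rewrite (_ : _ + _ = (r%:Z - (m - n%:Z)) + m); last by ring.
  by rewrite rpredD ?rE ?NE ?dvdn_mulr // /m PoszM mulrCA dvdz_mulr.
rewrite -ramanujanN //; apply: ramanujan_eqmod => //.
rewrite eqz_mod_dvd -opprB rpredN.
rewrite (_ : _ - _ = r%:Z - (m - n%:Z)); last by rewrite /m; ring.
exact: rE.
Qed.

(** Either q divides d, which is then a period, or 4 divides q and both values vanish, n and n + d
    being odd. *)
Lemma ramanujan_half_shift (R : realType) (d q : nat) (n : int) :
  ~~ odd d -> (0 < d)%N -> (q %| 2 * d)%N -> ~~ (2 %| n)%Z ->
  ramanujan R q (n + d%:Z) = ramanujan R q n.
Proof.
move=> d2 d0 q2d n2.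
have q0 : (0 < q)%N by apply: dvdn_gt0 q2d; lia.
have [qd|qd] := boolP (q %| d)%N.
  apply: ramanujan_eqmod => //.
  by rewrite eqz_mod_dvd addrAC subrr add0r dvdzE.
(* An odd q dividing 2d would divide d. If q = 2r with r odd, then r and 2 both divide d, hence so
   does q. So r is even. *)
have q4 : (4 %| q)%N.
  have [q2|q2] := boolP (odd q).
    by move: q2d; rewrite Gauss_dvdr ?coprimen2 // (negPf qd).
  have [r qE] : exists r, (q = 2 * r)%N by exists q./2; lia.
  move: q2d qd; rewrite qE dvdn_pmul2l // => rd qd.
  have [r2|r2] := boolP (odd r).
    by move: qd; rewrite Gauss_dvd ?coprime2n // rd dvdn2 d2.
  by rewrite (_ : 4 = 2 * 2)%N // dvdn_pmul2l // dvdn2.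
rewrite !(@ramanujan_odd0 _ q) //.
apply: contra n2 => nd; lia.
Qed.

(** The shifts are even, so at positions 1 and 1 + d the Ramanujan sums are evaluated at an odd
    integer and at that integer plus d; [ramanujan_half_shift] makes these entries equal. *)
Lemma ramanujan_system_not_frame2 (R : realType) (N d K : nat)
    (q : K.-tuple nat) : ~~ odd d -> (0 < d)%N -> N = (2 * d)%N ->
  (forall i, tnth q i %| N)%N -> ~ is_frame (@ramanujan_system R N 2 d K q).
Proof.
move=> d2 d0 NE qN.
have N1 : (1 < N)%N by lia.
have Nd : (1 + d < N)%N by lia.
pose n1 := Ordinal N1; pose nd := Ordinal Nd.
have n1d : nd == n1 = false by apply/negbTE; rewrite -val_eqE /=; lia.
apply: (@orthogonal_not_frame _ _ _ _ (delta_mx 0 n1 - delta_mx 0 nd)).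
  apply/negP => /eqP/rowP/(_ n1); rewrite !mxE !eqxx [n1 == _]eq_sym n1d subr0.
  by move=> /eqP; rewrite oner_eq0.
have dE (f : 'rV[R[i]]_N) m : dotmx (delta_mx 0 m) f = Num.conj (f 0 m).
  rewrite dotmx_sumE (bigD1 m) //= big1 => [|n nm].
    by rewrite mxE !eqxx mul1r addr0.
  by rewrite mxE (negPf nm) andbF mul0r.
move=> j; rewrite linearBl /= !dE !ramanujan_systemE //=.
rewrite PoszD addrAC ramanujan_half_shift ?subrr // -?NE //.
lia.
Qed.

(** * The Gram kernel and the tight cases *)

Lemma partition_by_divisor (V : nmodType) (N : nat) (F : 'I_N -> V) :
  (0 < N)%N ->
  \sum_(t <- divisors N) \sum_(i < N | gcdn i N == (N %/ t)%N) F i =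
  \sum_(i < N) F i.
Proof.
move=> N0; rewrite (exchange_big_dep predT) //=; apply: eq_bigr => i _.
have divK c : (c %| N)%N -> (N %/ (N %/ c) = c)%N.
  by move=> cN; rewrite -{1}(divnK cN) mulKn // divn_gt0 ?(dvdn_leq N0) ?(dvdn_gt0 N0).
have gN : (gcdn i N %| N)%N by exact: dvdn_gcdr.
(* Since t -> N/t is an involution on the divisors, i is counted exactly once, at t = N/gcd(i,
   N). *)
rewrite big_mkcond (bigD1_seq (N %/ gcdn i N)%N) ?divisors_uniq //=; last first.
  by rewrite -dvdn_divisors // dvdn_div.
rewrite divK // eqxx big1_seq ?addr0 // => t /andP[tg]; rewrite -dvdn_divisors // => tN.
by case: eqP => // gE; rewrite gE divK ?eqxx in tg.
Qed.

(** After expansion in characters, the sum over k of e^(2 i pi (a - b) k / d) is d or 0 according to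
    whether d divides a - b. The last hypothesis then leaves only the pairs a = b. *)
Lemma gram_ramanujan_shifts (R : realType) (N p d t : nat) (n m : int) :
  (0 < d)%N -> (0 < p)%N -> N = (p * d)%N -> (t %| N)%N ->
  (forall a b : 'I_N, gcdn a N = gcdn b N -> (d%:Z %| a%:Z - b%:Z)%Z -> a = b) ->
  \sum_(k < d) Num.conj (ramanujan R t (n - (p * k)%N%:Z)) *
    ramanujan R t (m - (p * k)%N%:Z) =
  \sum_(a < N | gcdn a N == (N %/ t)%N) d%:R * omega R N ((m - n) * a%:Z).
Proof.
move=> d0 p0 NE tN inj; have N0 : (0 < N)%N by rewrite NE muln_gt0 p0.
pose P (a : 'I_N) := gcdn a N == (N %/ t)%N.
transitivity (\sum_(k < d) \sum_(a | P a) \sum_(b | P b)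
    omega R N (b%:Z * m - a%:Z * n) * omega R d ((a%:Z - b%:Z) * k%:Z)).
  apply: eq_bigr => k _; rewrite !(@ramanujan_gcdn _ N t) //.
  rewrite rmorph_sum big_distrlr; apply: eq_bigr => a _; apply: eq_bigr => b _.
  (* As N = pd, a d-th root of unity is rewritten as an N-th root with exponent multiplied by p. *)
  rewrite /= conj_omega -omegaD -(@omega_scale _ d p) // (mulnC d) -NE -omegaD.
  by congr omega; rewrite PoszM; ring.
rewrite exchange_big /=; apply: eq_bigr => a Pa.
rewrite exchange_big /= (bigD1 a) //= [X in _ + X]big1 => [|b /andP[Pb ba]].
  under eq_bigr do rewrite subrr mul0r omega0 mulr1.
  rewrite sumr_const card_ord addr0 mulr_natl; congr (omega _ _ _ *+ _); ring.
rewrite -mulr_sumr sum_omega //; case: ifP => [|_]; last by rewrite mulr0.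
move=> dab; have ab : a = b by apply: inj => //; rewrite (eqP Pa) (eqP Pb).
by rewrite ab eqxx in ba.
Qed.

(** In the bound, d comes from orthogonality over the shifts. The divisors together let the
    frequency run through all of Z_N, and orthogonality there gives N when n = m and 0 otherwise. *)
Lemma ramanujan_system_tight (R : realType) (N p d K : nat) (q : K.-tuple nat) :
  (0 < p)%N -> (0 < d)%N -> N = (p * d)%N -> perm_eq q (divisors N) ->
  (forall a b : 'I_N, gcdn a N = gcdn b N -> (d%:Z %| a%:Z - b%:Z)%Z -> a = b) ->
  is_tight_frame (@ramanujan_system R N p d K q) (d * N)%:R.
Proof.
move=> p0 d0 NE qP inj; have N0 : (0 < N)%N by rewrite NE muln_gt0 p0.
have qN i : (tnth q i %| N)%N.
  by rewrite (dvdn_divisors _ N0) -(perm_mem qP) mem_tnth.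
apply: gram_tight_frame => [|n m]; first by rewrite ltr0n muln_gt0 d0.
pose G t (k : 'I_d) := Num.conj (ramanujan R t (n%:Z - (p * k)%N%:Z)) *
    ramanujan R t (m%:Z - (p * k)%N%:Z).
transitivity (\sum_(k < d) \sum_(i < K) G (tnth q i) k).
  by rewrite pair_bigA; apply: eq_bigr => j _; rewrite !ramanujan_systemE.
rewrite exchange_big /= -(big_tuple _ _ q predT (fun t => \sum_(k < d) G t k)).
rewrite (perm_big _ qP) /=.
under eq_big_seq => t tN.
  rewrite (@gram_ramanujan_shifts _ N) //; last by rewrite dvdn_divisors.
  over.
rewrite partition_by_divisor // -mulr_sumr sum_omega // rmorph_nat natrM.
rewrite mulr_natl -eqz_mod_dvd !modz_small ?ltz_nat ?ltn_ord // eqz_nat eq_sym.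
by rewrite val_eqE; case: eqP => _; rewrite ?mul1r ?mul0r ?mulr_natl ?mul0rn.
Qed.

Theorem theorem2p6 (R : realType) (N p d K : nat) (q : K.-tuple nat)
    (hp : (0 < p)%N) (hd : (0 < d)%N) (hN : N = (p * d)%N)
    (hq : perm_eq q (divisors N)) (hK : (p <= K)%N) :
  [/\ (p = 1%N ->
         is_tight_frame (@ramanujan_system R N p d K q) (N ^ 2)%:R),
      (p = 2%N ->
         (odd d ->
            is_tight_frame (@ramanujan_system R N p d K q) (2 * d ^ 2)%:R) /\
         (~~ odd d -> ~ is_frame (@ramanujan_system R N p d K q)))
    & ((2 < p)%N -> ~ is_frame (@ramanujan_system R N p d K q))].
Proof.
have N0 : (0 < N)%N by rewrite hN muln_gt0 hp.
have qN i : (tnth q i %| N)%N.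
  by rewrite (dvdn_divisors _ N0) -(perm_mem hq) mem_tnth.
have ord_eqmod (a b : 'I_N) : (N%:Z %| a%:Z - b%:Z)%Z -> a = b.
  rewrite -eqz_mod_dvd !modz_small ?ltz_nat ?ltn_ord // eqz_nat val_eqE.
  by move=> /eqP.
split=> [p1|p2|p3].
- have -> : (N ^ 2 = d * N)%N by rewrite hN p1; lia.
  apply: ramanujan_system_tight => // a b _.
  by rewrite -(mul1n d) -p1 -hN => /ord_eqmod.
- split=> [d_odd|d_even]; last by subst p; exact: ramanujan_system_not_frame2.
  have -> : (2 * d ^ 2 = d * N)%N by rewrite hN p2; lia.
  apply: ramanujan_system_tight => // a b abN dab; apply: ord_eqmod.
  (* Equal gcds with the even number N give a and b the same parity; together with a = b mod d and d
     odd, this gives a = b mod 2d. *)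
  have N2 : (2 %| N)%N by rewrite hN p2 dvdn_mulr.
  have : (2 %| a)%N = (2 %| b)%N.
    by have := dvdn_gcd 2 a N; rewrite abN dvdn_gcd N2 !andbT.
  rewrite [X in (Posz X %| _)%Z]hN p2 PoszM Gauss_dvdz ?dab ?andbT; first by clear; lia.
  by rewrite coprimezE coprime2n.
- exact: ramanujan_system_not_frame_gt2.
Qed.
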